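(* The semigroup $Q$ given by the semigroup presentation $$Q = \langle a,b,c,e,x \mid xb = cx,\ ac = ca,\ ae=ea,\ ec=ce,\ xca = xe,\ aex = ax\rangle$$ is $\mathcal{J}$-trivial.
   Context: For a semigroup $S$, $S^1$ denotes $S$ if $S$ has an identity and $S$ with an external identity adjoined otherwise. Elements $x,y\in S$ are $\mathcal{J}$-related if $S^1xS^1 = S^1yS^1$. $S$ is $\mathcal{J}$-trivial if any two $\mathcal{J}$-related elements are equal. The presentation is a semigroup presentation: $Q$ is the quotient of the free semigroup (nonempty words) on the generators by the congruence generated by the relations; the generator $e$ is not assumed to be idempotent or an identity. *)

(* Defs.v *)
From HB Require Import structures.
From mathcomp Require Import all_boot.
From mathcomp Require Import boolp classical_sets.

Set Implicit Arguments.
Unset Strict Implicit.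
Unset Printing Implicit Defensive.

Import Algebra.

Local Open Scope classical_set_scope.
Local Open Scope group_scope.
Local Open Scope quotient_scope.

Section Jtrivial.
Variable S : semigroupType.
Implicit Types (s t : S) (u v : option S).

Definition has_identity := exists i : S, left_id i *%g /\ right_id i *%g.

(* [None] plays the role of an external identity for [S]. *)
Definition omul u v : option S :=
  match u, v with
  | Some s, Some t => Some (s * t)
  | Some s, None => Some s
  | None, _ => v
  end.

(* S^1 inside [option S]: the external identity is present only when [S] has
   no identity of its own. *)
Definition adjoin1 : set (option S) := [set u | u = None -> ~ has_identity].

(* S^1 s S^1 *)
Definition principal_ideal s : set (option S) :=
  [set omul (omul u (Some s)) v | u in adjoin1 & v in adjoin1].

Definition J_related s t := principal_ideal s = principal_ideal t.

Definition J_trivial := forall s t, J_related s t -> s = t.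

End Jtrivial.

Section FreeSemigroup.
Variable X : choiceType.

Record word := Word { letters :> seq X; _ : letters != [::] }.

HB.instance Definition _ := [isSub for letters].
HB.instance Definition _ := [Choice of word by <:].

Lemma word_cat_subproof (u v : word) : letters u ++ letters v != [::].
Proof. by case: u => -[]. Qed.

Definition word_cat (u v : word) : word := Word (word_cat_subproof u v).

Lemma word_catA : associative word_cat.
Proof. by move=> u v w; apply: val_inj; rewrite /= catA. Qed.

HB.instance Definition _ := isSemigroup.Build word word_catA.

Definition word1 (g : X) : word := @Word [:: g] isT.

End FreeSemigroup.

Section Presentation.
Variables (X : choiceType) (R : word X -> word X -> Prop).

Inductive congruence_gen : word X -> word X -> Prop :=
| Cong_base u v : R u v -> congruence_gen u v
| Cong_refl u : congruence_gen u u
| Cong_sym u v : congruence_gen u v -> congruence_gen v u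
| Cong_trans u v w :
    congruence_gen u v -> congruence_gen v w -> congruence_gen u w
| Cong_mul u u' v v' :
    congruence_gen u u' -> congruence_gen v v' ->
    congruence_gen (u * v) (u' * v').

Definition congruence_genb : rel (word X) := fun u v => `[< congruence_gen u v >].

Lemma congruence_genb_refl : reflexive congruence_genb.
Proof. by move=> u; apply/asboolP/Cong_refl. Qed.

Lemma congruence_genb_sym : symmetric congruence_genb.
Proof. by move=> u v; apply/asboolP/asboolP; apply: Cong_sym. Qed.

Lemma congruence_genb_trans : transitive congruence_genb.
Proof.
by move=> v u w /asboolP uv /asboolP vw; apply/asboolP; apply: Cong_trans vw.
Qed.

Canonical congruence_equiv := EquivRel congruence_genb
  congruence_genb_refl congruence_genb_sym congruence_genb_trans.

Definition presented := {eq_quot congruence_equiv}.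

HB.instance Definition _ := Choice.on presented.

Definition pclass (u : word X) : presented := \pi_presented u.

Lemma pclassP (u v : word X) : pclass u = pclass v <-> congruence_gen u v.
Proof.
split=> [/eqmodP/asboolP //|uv].
by apply/eqmodP/asboolP.
Qed.

Definition presented_mul : presented -> presented -> presented :=
  lift_op2 presented (@mul (word X)).

Lemma pclassM (u v : word X) :
  presented_mul (pclass u) (pclass v) = pclass (u * v).
Proof.
rewrite /presented_mul -lock; apply/pclassP.
by apply: Cong_mul; apply/pclassP; rewrite /pclass reprK.
Qed.

Lemma presented_mulA : associative presented_mul.
Proof.
move=> p q r; rewrite -[p]reprK -[q]reprK -[r]reprK -!/(pclass _).
by rewrite !pclassM mulgA.
Qed.

HB.instance Definition _ := isSemigroup.Build presented presented_mulA.

End Presentation.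

Inductive generator := Ga | Gb | Gc | Ge | Gx.

Definition generator_code g : nat :=
  match g with Ga => 0 | Gb => 1 | Gc => 2 | Ge => 3 | Gx => 4 end.

Definition generator_decode n : generator := nth Gx [:: Ga; Gb; Gc; Ge] n.

Lemma generator_codeK : cancel generator_code generator_decode.
Proof. by case. Qed.

HB.instance Definition _ := Choice.copy generator (can_type generator_codeK).

Inductive Qrel : word generator -> word generator -> Prop :=
| Qrel_xb : Qrel (word1 Gx * word1 Gb) (word1 Gc * word1 Gx)
| Qrel_ac : Qrel (word1 Ga * word1 Gc) (word1 Gc * word1 Ga)
| Qrel_ae : Qrel (word1 Ga * word1 Ge) (word1 Ge * word1 Ga)
| Qrel_ec : Qrel (word1 Ge * word1 Gc) (word1 Gc * word1 Ge)
| Qrel_xca : Qrel (word1 Gx * word1 Gc * word1 Ga) (word1 Gx * word1 Ge)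
| Qrel_aex : Qrel (word1 Ga * word1 Ge * word1 Gx) (word1 Ga * word1 Gx).

Definition Q : semigroupType := presented Qrel.

(* Main.v *)
(** If [s = p t p'] and [t = r s r'] in [Q^1], then [t = z t z'] with [z = r p] and
    [z' = p' r']. Each of the following is an invariant of the defining relations:
    the number of [x]'s; the numbers of [a]'s and [b]'s before the first [x];
    the number of [a]'s and [e]'s after the last [x];
    the integer [#b + #c - #a].
    The first three force [z] to be a word in [c], [e] and [z'] to be a word in
    [b], [c]; the last one then forces [z' = 1] and [z = e^k], so that
    [s] is a power of [e] times [t]. Finally, either a
    word representing [t] starts with a word in [a], [c], [e] that contains an [a]
    and is followed by [x], in which case [e t = t], or the number of [e]'s before
    the first [b] or [x] is invariant, in which case [k = 0]. *)
From mathcomp Require Import all_boot ssralg ssrint zify.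
From mathcomp Require Import boolp classical_sets.
Require Import Defs.

Set Implicit Arguments.
Unset Strict Implicit.
Unset Printing Implicit Defensive.

Import Algebra.

(** [f] need not be a morphism, so the induction carries arbitrary contexts [l], [r]: in a product
    one factor is replaced at a time, the other joining the context. *)
Lemma congruence_gen_invariant (X : choiceType) (R : word X -> word X -> Prop)
    (T : Type) (f : seq X -> T) :
  (forall u v l r, R u v ->
     f (l ++ letters u ++ r) = f (l ++ letters v ++ r)) ->
  forall u v, congruence_gen R u v -> f (letters u) = f (letters v).
Proof.
move=> fR u v uv.
suff: forall l r, f (l ++ letters u ++ r) = f (l ++ letters v ++ r).
  by move=> /(_ [::] [::]); rewrite !cats0.
elim: uv => {u v} [u v uv|u|u v _ IH|u v w _ IHuv _ IHvw|u u' v v' _ IHu _ IHv] l r.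
- exact: fR.
- by [].
- by rewrite IH.
- by rewrite IHuv.
- by rewrite /= -!catA IHu catA IHv -catA.
Qed.

Section OptionMonoid.
Variable S : semigroupType.

Lemma omulA : associative (@omul S).
Proof. by move=> [p|] [q|] [r|] //=; rewrite mulgA. Qed.

Lemma omul1 : right_id None (@omul S).
Proof. by case. Qed.

(** [s] lies in its own ideal; the multipliers witnessing this are the identity of [S] if there is
    one, since [adjoin1] then excludes [None], and [None] otherwise. *)
Lemma J_related_factor (s t : S) :
  J_related s t -> exists p q, Some s = omul (omul p (Some t)) q.
Proof.
move=> st; have: principal_ideal s (Some s).
  have [[i [il ir]]|noid] := pselect (has_identity S).
    exists (Some i) => //; exists (Some i) => //=; by rewrite il ir.
  by exists None => //; exists None.
by rewrite st => -[p _ [q _ <-]]; exists p, q.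
Qed.

End OptionMonoid.

(** * Words as representatives of elements of the monoid with adjoined identity *)

Section Evaluation.
Variables (X : choiceType) (R : word X -> word X -> Prop).
Notation S := (presented R).

(** The monoid morphism from the free monoid, so that multipliers, possibly empty, are handled as
    words too. *)
Definition ev (w : seq X) : option S :=
  foldr (fun g => omul (Some (pclass R (word1 g)))) None w.

Lemma ev_cons g w : ev (g :: w) = omul (Some (pclass R (word1 g))) (ev w).
Proof. by []. Qed.

Lemma ev_cat w w' : ev (w ++ w') = omul (ev w) (ev w').
Proof. by elim: w => // g w IH; rewrite cat_cons !ev_cons IH omulA. Qed.

Lemma ev_letters (u : word X) : ev (letters u) = Some (pclass R u).
Proof.
case: u => w; elim: w => // g [|h w] IH wN.
  by congr (Some (pclass _ _)); apply: val_inj.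
have -> : ev (letters (Word wN)) = omul (ev [:: g]) (ev (h :: w)) by [].
rewrite (IH isT) /=; congr Some; rewrite [LHS]pclassM.
by congr pclass; apply: val_inj.
Qed.

Lemma ev_surj (p : option S) : exists w, ev w = p.
Proof.
case: p => [p|]; last by exists [::].
by exists (letters (repr p)); rewrite ev_letters /pclass reprK.
Qed.

Lemma ev_invariant (T : Type) (f : seq X -> T) :
  (forall u v l r, R u v ->
     f (l ++ letters u ++ r) = f (l ++ letters v ++ r)) ->
  forall w w', ev w = ev w' -> f w = f w'.
Proof.
move=> fR [|g w] [|g' w'] //.
  by rewrite -[g' :: w']/(letters (@Word _ (g' :: w') isT)) ev_letters.
  by rewrite -[g :: w]/(letters (@Word _ (g :: w) isT)) ev_letters.
rewrite -[g :: w]/(letters (@Word _ (g :: w) isT)).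
rewrite -[g' :: w']/(letters (@Word _ (g' :: w') isT)).
rewrite !ev_letters => -[/pclassP]; exact: congruence_gen_invariant.
Qed.

Lemma ev_rel (u v : word X) l r :
  R u v -> ev (l ++ letters u ++ r) = ev (l ++ letters v ++ r).
Proof.
move=> uv; rewrite !ev_cat !ev_letters.
by have /pclassP-> : congruence_gen R u v by apply: Cong_base.
Qed.

End Evaluation.

(** * Invariants of the defining relations *)

Notation evQ := (ev Qrel).

Lemma count_x_invariant w w' :
  evQ w = evQ w' -> count_mem Gx w = count_mem Gx w'.
Proof.
apply: ev_invariant => u v l r; rewrite !count_cat.
by case.
Qed.

Fixpoint ab_before_x (w : seq generator) : nat :=
  match w with
  | [::] | Gx :: _ => 0
  | g :: w => (g \in [:: Ga; Gb]) + ab_before_x w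
  end.

Lemma ab_before_x_invariant w w' :
  evQ w = evQ w' -> ab_before_x w = ab_before_x w'.
Proof.
apply: ev_invariant => u v l r uv.
by elim: l => [|[] l IH] /=; rewrite ?IH //; case: uv.
Qed.

Lemma ab_before_x_catl (z w : seq generator) : Gx \notin z ->
  ab_before_x (z ++ w) = count [in [:: Ga; Gb]] z + ab_before_x w.
Proof. by elim: z => // -[] z IH; rewrite inE //= => /IH ->. Qed.

(** Equality can fail when [w] has no x, since the count then runs on into [z]. *)
Lemma ab_before_x_catr w z : ab_before_x w <= ab_before_x (w ++ z).
Proof. by elim: w => //= -[] w IH //=; rewrite leq_add2l. Qed.

Fixpoint ae_after_x (w : seq generator) : nat :=
  if w is g :: w then
    if Gx \in w then ae_after_x w else (g \in [:: Ga; Ge]) + ae_after_x w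
  else 0.

Lemma ae_after_x_invariant w w' :
  evQ w = evQ w' -> ae_after_x w = ae_after_x w'.
Proof.
apply: ev_invariant => u v l r uv; elim: l => [|g l IH] /=.
  by case: uv => /=; rewrite ?inE /=; case: (Gx \in r).
by rewrite IH !mem_cat; case: uv.
Qed.

Lemma ae_after_x_catl z w : ae_after_x w <= ae_after_x (z ++ w).
Proof.
elim: z => //= g z IH; case: ifP => // _; exact: leq_trans (leq_addl _ _).
Qed.

Lemma ae_after_x_free (z : seq generator) : Gx \notin z -> ae_after_x z = count [in [:: Ga; Ge]] z.
Proof.
by elim: z => //= g z IH; rewrite inE negb_or => /andP[_ zx]; rewrite (negPf zx) IH.
Qed.

Lemma ae_after_x_catr (w z : seq generator) : Gx \notin z ->
  ae_after_x (w ++ z) = ae_after_x w + count [in [:: Ga; Ge]] z.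
Proof.
move=> zx; elim: w => [|g w IH] /=; first exact: ae_after_x_free.
by rewrite mem_cat (negPf zx) orbF IH; case: ifP; rewrite ?addnA.
Qed.

(** The relation [xb = cx] trades a b for a c, and [xca = xe] drops a c and an a, whose weights
    cancel. *)
Definition bc_minus_a (w : seq generator) : int :=
  ((count [in [:: Gb; Gc]] w)%:Z - (count_mem Ga w)%:Z)%R.

Lemma bc_minus_a_invariant w w' :
  evQ w = evQ w' -> bc_minus_a w = bc_minus_a w'.
Proof.
apply: ev_invariant => u v l r uv; rewrite /bc_minus_a !count_cat.
by case: uv => /=; lia.
Qed.

(* [None] stands for a word in [{a,c,e}* x ...] with an [a] before that [x];
   the flag records whether an [a] has already been read. *)
Fixpoint e_prefix (seen_a : bool) (w : seq generator) : option nat :=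
  match w with
  | [::] | Gb :: _ => Some 0
  | Gx :: _ => if seen_a then None else Some 0
  | Ga :: w => e_prefix true w
  | Gc :: w => e_prefix seen_a w
  | Ge :: w => omap succn (e_prefix seen_a w)
  end.

(** Ahead of the first b or x only [aex = ax] changes the number of e's, and there the a just read
    makes both values [None]. The induction on the left context must let the flag vary. *)
Lemma e_prefix_invariant w w' :
  evQ w = evQ w' -> e_prefix false w = e_prefix false w'.
Proof.
apply: ev_invariant => u v l r uv.
elim: l false => [|[] l IH] s //=; last by rewrite IH.
by case: uv.
Qed.

Lemma e_prefix_nseq s k w :
  e_prefix s (nseq k Ge ++ w) = omap (addn k) (e_prefix s w).
Proof. by elim: k => [|k /= ->]; case: (e_prefix s w). Qed.

(** * Absorption of a leading e *)

Lemma ev_ca l r : evQ (l ++ [:: Ga, Gc & r]) = evQ (l ++ [:: Gc, Ga & r]).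
Proof. exact: (ev_rel _ _ Qrel_ac). Qed.

Lemma ev_ea l r : evQ (l ++ [:: Ga, Ge & r]) = evQ (l ++ [:: Ge, Ga & r]).
Proof. exact: (ev_rel _ _ Qrel_ae). Qed.

Lemma ev_ce l r : evQ (l ++ [:: Ge, Gc & r]) = evQ (l ++ [:: Gc, Ge & r]).
Proof. exact: (ev_rel _ _ Qrel_ec). Qed.

Lemma ev_aex l r : evQ (l ++ [:: Ga, Ge, Gx & r]) = evQ (l ++ [:: Ga, Gx & r]).
Proof. exact: (ev_rel _ _ Qrel_aex). Qed.

(** A factor [ae] is moved right through a, c and e until it meets x, where [aex = ax] removes its
    e; a b met earlier would make [e_prefix] a [Some]. *)
Lemma e_absorbed_after_a w : e_prefix true w = None ->
  evQ [:: Ga, Ge & w] = evQ (Ga :: w).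
Proof.
elim: w => // -[] // w IH wN.
- by rewrite -[LHS](ev_ea [:: Ga]) ev_cons IH.
- by rewrite [LHS](ev_ce [:: Ga]) [LHS](ev_ca [::]) [RHS](ev_ca [::]) ev_cons IH.
- rewrite [LHS](ev_ea [::]) [RHS](ev_ea [::]) ev_cons IH //.
  by move: wN => /=; case: (e_prefix true w).
- exact: (ev_aex [::]).
Qed.

(** The e commutes with each c up to the first a, behind which it is absorbed. *)
Lemma e_absorbed w : e_prefix false w = None -> evQ (Ge :: w) = evQ w.
Proof.
elim: w => // -[] // w IH wN.
- by rewrite -[LHS](ev_ea [::]) e_absorbed_after_a.
- by rewrite [LHS](ev_ce [::]) ev_cons IH.
- have {}wN : e_prefix false w = None by move: wN => /=; case: (e_prefix false w).
  rewrite ev_cons IH //; exact: IH.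
Qed.

Lemma fixing_pair (z w z' : seq generator) : evQ (z ++ w ++ z') = evQ w ->
  z' = [::] /\ z = nseq (size z) Ge.
Proof.
move=> zwz.
have [zx z'x] : Gx \notin z /\ Gx \notin z'.
  move/count_x_invariant: zwz; rewrite !count_cat => xE.
  by split; apply/count_memPn; lia.
have zab : count [in [:: Ga; Gb]] z = 0.
  move/ab_before_x_invariant: zwz; rewrite ab_before_x_catl //.
  have := ab_before_x_catr w z'; lia.
have z'ae : count [in [:: Ga; Ge]] z' = 0.
  move/ae_after_x_invariant: zwz; rewrite catA ae_after_x_catr //.
  have := ae_after_x_catl z w; lia.
have letter_split (u : seq generator) : size u = count_mem Ga u + count_mem Gb u
    + count_mem Gc u + count_mem Ge u + count_mem Gx u.
  by elim: u => //= -[] u -> /=; lia.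
have count2 (g h : generator) u : g != h ->
    count [in [:: g; h]] u = count_mem g u + count_mem h u.
  move=> gh; elim: u => //= k u ->; rewrite !inE.
  by case: (eqVneq k g) gh => [->|_] /=; [move/negPf->|]; lia.
move: zab z'ae; rewrite !count2 // => zab z'ae.
move/count_memPn: zx => zx; move/count_memPn: z'x => z'x.
have := letter_split z; have := letter_split z'.
(* No a is left in [z] or [z'], so their contributions are nonnegative with sum 0: neither contains
   b or c. *)
move/bc_minus_a_invariant: zwz; rewrite /bc_minus_a !count_cat !count2 // => chi sz' sz.
split; first by apply: size0nil; lia.
apply/all_pred1P; rewrite all_count sz; lia.
Qed.

Theorem proposition9 : J_trivial Q.
Proof.
move=> s t st.
have [p0 [p0' sE]] := J_related_factor st.
have [r0 [r0' tE]] := J_related_factor (esym st).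
have [[p pE] [p' p'E]] := (ev_surj p0, ev_surj p0').
have [[r rE] [r' r'E]] := (ev_surj r0, ev_surj r0').
have [w wE] := ev_surj (Some t).
move: sE tE; rewrite -{}pE -{}p'E -{}rE -{}r'E -wE => {p0 p0' r0 r0'} sE tE.
have fix_w : evQ ((r ++ p) ++ w ++ (p' ++ r')) = evQ w.
  by rewrite !ev_cat [RHS]tE sE !omulA.
have [pr'0] := fixing_pair fix_w.
have {pr'0}[p'0 r'0] : p' = [::] /\ r' = [::] by case: p' pr'0 {sE fix_w}.
rewrite size_cat nseqD => /eqP; rewrite eqseq_cat ?size_nseq //.
move: (size r) (size p) => l k /andP[/eqP rE /eqP pE].
apply: Some_inj; rewrite sE -wE p'0 omul1 pE.
case wN: (e_prefix false w) => [n|]; last first.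
  rewrite -ev_cat; elim: k {pE} => // k IH.
  by rewrite [nseq _ _]/= cat_cons ev_cons IH -ev_cons e_absorbed.
(* Now [e_prefix] turns the word equality into [l + (k + n) = n]. *)
move: fix_w; rewrite p'0 r'0 !cats0 rE pE -catA => /e_prefix_invariant.
rewrite !e_prefix_nseq wN => -[lkn].
by have -> : k = 0 by lia.
Qed.
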